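(* Let $\mathbb K\in\{\mathbb R,\mathbb C\}$, let $X\subseteq\mathbb K^n$ be an analytic set with $0\in X$, and let $u\in T_0X\setminus\{0\}$. If $X$ is second-order realizable along $u$, then $$T^2_{0,u}X=T^{2,a}_{0,u}X.$$
   Context: An analytic function is one that is locally given by convergent power series (real-analytic for $\mathbb K=\mathbb R$, holomorphic for $\mathbb K=\mathbb C$). An analytic set $X$ in an open set $U\subseteq\mathbb K^n$ is a subset of $U$ such that every $a\in U$ has a neighborhood $V\subseteq U$ on which $X\cap V$ is the common zero set of finitely many analytic functions $V\to\mathbb K$. $\mathcal I(X,0)$ is the ideal of germs at $0$ of analytic functions on $\mathbb K^n$ that vanish on $X\cap V$ for some neighborhood $V$ of $0$. Geometric tangent cone: $T_0X$ is the set of $v\in\mathbb K^n$ for which there are $x_k\in X\setminus\{0\}$ and real $t_k>0$ with $x_k\to0$ and $t_kx_k\to v$. For a nonzero germ $f=f_m+f_{m+1}+\cdots$ (power series expansion at $0$ into homogeneous polynomials $f_j$ of degree $j$, with $f_m\not\equiv0$), $f^{[*]}:=f_m$ is the initial form and $f^{[*]+1}:=f_{m+1}$ (possibly zero). $T^2_{0,u}X$ is the set of all $w\in\mathbb K^n$ for which there are positive real numbers $t_k\downarrow0$ and $w_k\in\mathbb K^n$ with $w_k\to w$ such that $t_ku+\frac12t_k^2w_k\in X$ for every $k$. $T^{2,a}_{0,u}X:=\{w\in\mathbb K^n:\ \tfrac12\langle\nabla f^{[*]}(u),w\rangle+f^{[*]+1}(u)=0\ \text{ for all nonzero } f\in\mathcal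 I(X,0)\}$, where $\nabla$ is the vector of partial derivatives over $\mathbb K$ and $\langle a,b\rangle=\sum_i a_ib_i$ (bilinear). $X$ is second-order realizable along $u$ if for every $w\in T^{2,a}_{0,u}X$ there exist $\varepsilon>0$ and an analytic curve $\gamma:(0,\varepsilon)\to X$ such that $\gamma(t)=tu+\frac12t^2w+o(t^2)$ as $t\to0^+$. A curve on the real interval $(0,\varepsilon)$ is analytic if near each point its components are given by convergent power series in $t$ with coefficients in $\mathbb K$. *)

(* Defs.v *)
From HB Require Import structures.
From mathcomp Require Import all_boot all_order all_algebra complex.
From mathcomp Require Import all_classical all_reals all_analysis.
(* The notations of mpoly clash with those of mathcomp-analysis: below,
   [mpoly n K] is the ring of polynomials in n variables over K, [meval v p]
   is p(v), [mderiv i p] is the i-th partial derivative of p, [mcoeff m p]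
   is the coefficient of p at the monomial m and [ishomog1 d mdeg] is the
   predicate "homogeneous of degree d" (satisfied by 0 for every d). *)
From mathcomp Require Export -(notations) mpoly.

Set Implicit Arguments.
Unset Strict Implicit.
Unset Printing Implicit Defensive.

Import Order.TTheory GRing.Theory Num.Theory.
Import numFieldNormedType.Exports.

Local Open Scope classical_set_scope.
Local Open Scope complex_scope.
Local Open Scope ring_scope.

Inductive scalar_kind := RealScalars | ComplexScalars.

Definition scalars (R : realType) (k : scalar_kind) : numFieldType :=
  match k with RealScalars => R | ComplexScalars => R[i] end.

Definition of_real (R : realType) (k : scalar_kind) : R -> scalars R k :=
  match k with
  | RealScalars => fun t => t
  | ComplexScalars => fun t => t%:C
  end.

(* A power series at 0 in n variables is given by its homogeneous parts
   p 0, p 1, p 2, ...; its monomials are those of the p j. *)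
Definition power_series (K : numFieldType) (n : nat) (p : nat -> mpoly n K) :=
  forall j, p j \is ishomog1 j mdeg.

Definition monomial_norms (K : numFieldType) (n : nat) (p : mpoly n K)
    (x : 'rV[K]_n) : K :=
  \sum_(m <- msupp p) `|mcoeff m p| * \prod_(i < n) `|x 0 i| ^+ m i.

Definition abs_converges_to (K : numFieldType) (n : nat)
    (p : nat -> mpoly n K) (x : 'rV[K]_n) (s : K) :=
  cvgn (series (fun j => monomial_norms (p j) x)) /\
  series (fun j => meval (x 0) (p j)) @ \oo --> s.

Definition expansion_at (K : numFieldType) (n : nat) (f : 'rV[K]_n -> K)
    (a : 'rV[K]_n) (p : nat -> mpoly n K) :=
  power_series p /\ \forall x \near a, abs_converges_to p (x - a) (f x).

(* Functions defined on an open set V are represented by total functions, whose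
   values outside V are irrelevant. *)
Definition analytic_on (K : numFieldType) (n : nat) (V : set 'rV[K]_n)
    (f : 'rV[K]_n -> K) :=
  forall a, V a -> exists p, expansion_at f a p.

Definition analytic_set (K : numFieldType) (n : nat) (U X : set 'rV[K]_n) :=
  [/\ open U, X `<=` U &
    forall a, U a -> exists V : set 'rV[K]_n,
      [/\ open V, V a, V `<=` U &
        exists (r : nat) (g : 'I_r -> 'rV[K]_n -> K),
          (forall i, analytic_on V (g i)) /\
          X `&` V = [set x | V x /\ forall i, g i x = 0]]].

(* [vanishing_germ X f]: the germ of f at 0 belongs to the ideal I(X, 0). *)
Definition vanishing_germ (K : numFieldType) (n : nat) (X : set 'rV[K]_n)
    (f : 'rV[K]_n -> K) :=
  exists V : set 'rV[K]_n,
    [/\ open V, V 0, analytic_on V f & forall x, X x -> V x -> f x = 0].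

Definition nonzero_germ (K : numFieldType) (n : nat) (f : 'rV[K]_n -> K) :=
  ~ (\forall x \near (0 : 'rV[K]_n), f x = 0).

(* For f with expansion p at 0, the initial form of f is p m and the form of
   the next degree is p m.+1. *)
Definition initial_degree (K : numFieldType) (n : nat) (p : nat -> mpoly n K)
    (m : nat) :=
  p m != 0 /\ forall j, (j < m)%N -> p j = 0.

Definition tangent_cone (R : realType) (k : scalar_kind) (n : nat)
    (X : set 'rV[scalars R k]_n) : set 'rV[scalars R k]_n :=
  [set v | exists (x : nat -> 'rV[scalars R k]_n) (t : nat -> R),
    [/\ forall j, X (x j) /\ x j <> 0,
        forall j, 0 < t j,
        x @ \oo --> (0 : 'rV[scalars R k]_n) &
        (fun j => of_real k (t j) *: x j) @ \oo --> v]].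

Definition second_tangent (R : realType) (k : scalar_kind) (n : nat)
    (X : set 'rV[scalars R k]_n) (u : 'rV[scalars R k]_n) :
    set 'rV[scalars R k]_n :=
  [set w | exists (t : nat -> R) (w_ : nat -> 'rV[scalars R k]_n),
    [/\ forall j, 0 < t j, nonincreasing_seq t, t @ \oo --> (0 : R),
        w_ @ \oo --> w &
        forall j, X (of_real k (t j) *: u
                     + (2^-1 * of_real k (t j) ^+ 2) *: w_ j)]].

Definition algebraic_second_tangent (K : numFieldType) (n : nat)
    (X : set 'rV[K]_n) (u : 'rV[K]_n) : set 'rV[K]_n :=
  [set w | forall f : 'rV[K]_n -> K, vanishing_germ X f -> nonzero_germ f ->
    forall (p : nat -> mpoly n K) (m : nat),
      expansion_at f 0 p -> initial_degree p m ->
      2^-1 * (\sum_(i < n) meval (u 0) (mderiv i (p m)) * w 0 i)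
      + meval (u 0) (p m.+1) = 0].

Definition analytic_curve (R : realType) (k : scalar_kind) (n : nat)
    (e : R) (g : R -> 'rV[scalars R k]_n) :=
  forall t0 : R, 0 < t0 < e -> forall i : 'I_n,
    exists c : nat -> scalars R k,
      \forall t \near t0,
        series (fun j => c j * of_real k (t - t0) ^+ j) @ \oo --> g t 0 i.

Definition second_order_realizable (R : realType) (k : scalar_kind) (n : nat)
    (X : set 'rV[scalars R k]_n) (u : 'rV[scalars R k]_n) :=
  forall w, algebraic_second_tangent X u w ->
    exists (e : R) (g : R -> 'rV[scalars R k]_n),
      [/\ 0 < e, forall t, 0 < t < e -> X (g t), analytic_curve e g &
        (fun t : R => g t - (of_real k t *: u
                             + (2^-1 * of_real k t ^+ 2) *: w))
        =o_ ((0 : R)^'+) (fun t : R => of_real k t ^+ 2)].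

(* Main.v *)
(* If t_j u + (t_j^2 / 2) w_j lies on X, then evaluating the power series of
   f in I(X, 0) there and dividing by t_j^m gives, up to O(t_j^2),
   f_m(u + (t_j / 2) w_j) + t_j f_{m+1}(u + (t_j / 2) w_j); the terms of order 0
   and 1 in t_j must vanish, the first being f_m(u) and the second the equation
   that defines the algebraic second tangent set.  Conversely, sampling at
   t_j = e / (j + 2) a curve that realizes w shows that w is a second-order
   tangent vector. *)
Require Import Defs.
From mathcomp Require Import all_boot all_order all_algebra complex.
From mathcomp Require Import all_classical all_reals all_analysis.
Set Implicit Arguments.
Unset Strict Implicit.

Import Order.TTheory GRing.Theory Num.Theory.
Import numFieldNormedType.Exports.
Local Open Scope classical_set_scope.
Local Open Scope ring_scope.

(** * Limits and difference quotients of polynomials *)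

Lemma mpoly_ring_ind (K : comNzRingType) (n : nat) (P : mpoly n K -> Prop) :
  (forall c, P (mpolyC n c)) -> (forall i, P (mpolyX K (mnm1 i))) ->
  (forall p q, P p -> P q -> P (p + q)) ->
  (forall p q, P p -> P q -> P (p * q)) -> forall p, P p.
Proof.
move=> PC PX PD PM p; rewrite (mpolyE p); apply: big_ind => //.
  by rewrite -mpolyC0.
move=> m _; rewrite -mul_mpolyC; apply: (PM) => //.
rewrite mpolyXE_id; apply: big_ind => // [|i _].
  by rewrite -mpolyC1.
by elim: (m i) => [|k IH]; rewrite ?expr0 -?mpolyC1 // exprS; apply: PM.
Qed.

Lemma meval_cvg (K : numFieldType) (n : nat) (p : mpoly n K) (u : 'rV[K]_n)
    (v : nat -> 'rV[K]_n) :
  v @ \oo --> u -> (fun j => meval (v j 0) p) @ \oo --> meval (u 0) p.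
Proof.
move=> vu; elim/mpoly_ring_ind: p => [c|i|p q Hp Hq|p q Hp Hq].
- under eq_cvg do rewrite mevalC.
  by rewrite mevalC; apply: cvg_cst.
- under eq_cvg do rewrite mevalXU.
  rewrite mevalXU.
  exact: (continuous_cvg _ (@coord_continuous K 1 n 0 i u)).
- under eq_cvg do rewrite mevalD.
  by rewrite mevalD; apply: cvgD.
- under eq_cvg do rewrite mevalM.
  by rewrite mevalM; apply: cvgM.
Qed.

Lemma cvg_along_ray (K : numFieldType) (n : nat) (u w : 'rV[K]_n)
    (h : nat -> K) (z : nat -> 'rV[K]_n) :
  h @ \oo --> (0 : K) -> z @ \oo --> w ->
  (fun j => u + h j *: z j) @ \oo --> u.
Proof.
move=> h0 zw; rewrite -[X in _ --> X]addr0 -[X in _ + X](scale0r w).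
by apply: cvgD; [exact: cvg_cst|exact: cvgZ].
Qed.

(** Both sides are additive in [p] and obey the Leibniz rule at [u], so constants and variables
    suffice. The direction [z j] may move with [j], as the second-order vectors do. *)
Lemma meval_derive (K : numFieldType) (n : nat) (p : mpoly n K)
    (u w : 'rV[K]_n) (h : nat -> K) (z : nat -> 'rV[K]_n) :
  (forall j, h j != 0) -> h @ \oo --> (0 : K) -> z @ \oo --> w ->
  (fun j => (h j)^-1 * (meval ((u + h j *: z j) 0) p - meval (u 0) p)) @ \oo
    --> \sum_(i < n) meval (u 0) (mderiv i p) * w 0 i.
Proof.
move=> hn0 h0 zw; elim/mpoly_ring_ind: p => [c|i|p q Hp Hq|p q Hp Hq].
- under eq_cvg do rewrite !mevalC subrr mulr0.
  rewrite big1; first exact: cvg_cst.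
  by move=> i _; rewrite mderivC meval0 mul0r.
- under eq_cvg => j do rewrite !mevalXU !mxE (addrC (u 0 i)) addrK mulKf //.
  rewrite (bigD1 i) //= big1 ?addr0 => [|j ji].
    rewrite mderivX mnm1E eqxx scale1r.
    have -> : mnm_sub (mnm1 i) (mnm1 i) = @mnm0 n.
      by apply/mnmP => l; rewrite mnmBE mnm0E subnn.
    rewrite mpolyX0 meval1 mul1r.
    exact: (continuous_cvg _ (@coord_continuous K 1 n 0 i w)).
  by rewrite mderivX mnm1E eq_sym (negbTE ji) scale0r meval0 mul0r.
- under eq_cvg do rewrite !mevalD opprD addrACA mulrDr.
  under eq_bigr do rewrite mderivD mevalD mulrDl.
  by rewrite big_split; apply: cvgD.
- have -> : \sum_(i < n) meval (u 0) (mderiv i (p * q)) * w 0 i =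
    (\sum_(i < n) meval (u 0) (mderiv i p) * w 0 i) * meval (u 0) q +
    meval (u 0) p * (\sum_(i < n) meval (u 0) (mderiv i q) * w 0 i).
    rewrite mulr_suml mulr_sumr -big_split; apply: eq_bigr => i _.
    by rewrite mderivM mevalD !mevalM mulrDl mulrAC mulrA.
  (* Increment of a product: the increment of [p] is weighted by [q] at [u], that of [q] by [p] at
     the moving point, whose value tends to that at [u]. *)
  have E j : (h j)^-1 * (meval ((u + h j *: z j) 0) (p * q)
                         - meval (u 0) (p * q)) =
    (h j)^-1 * (meval ((u + h j *: z j) 0) p - meval (u 0) p)
      * meval (u 0) q
    + meval ((u + h j *: z j) 0) p *
      ((h j)^-1 * (meval ((u + h j *: z j) 0) q - meval (u 0) q)).
    rewrite !mevalM [X in _ = _ + X]mulrCA -mulrA -mulrDr; congr (_ * _).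
    by rewrite mulrBl mulrBr [RHS]addrC subrKA.
  under eq_cvg do rewrite E.
  apply: cvgD; first by apply: cvgM => //; exact: cvg_cst.
  by apply: cvgM => //; apply: meval_cvg; exact: (cvg_along_ray h0 zw).
Qed.

(** * Homogeneous parts and remainders of power series *)

Lemma prod_scale_homog (K : numDomainType) (n d : nat) (p : mpoly n K)
    (m : multinom n) (s : K) (y : 'I_n -> K) :
  p \is ishomog1 d mdeg -> m \in msupp p ->
  \prod_(i < n) (s * y i) ^+ m i = s ^+ d * \prod_(i < n) y i ^+ m i.
Proof.
move=> /dhomogP /[apply] <-.
under eq_bigr do rewrite exprMn.
by rewrite big_split /= mdegE expr_sum.
Qed.

Lemma meval_homogZ (K : numFieldType) (n d : nat) (p : mpoly n K)
    (s : K) (x : 'rV[K]_n) :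
  p \is ishomog1 d mdeg -> meval ((s *: x) 0) p = s ^+ d * meval (x 0) p.
Proof.
move=> hp; rewrite !mevalE mulr_sumr big_seq [RHS]big_seq.
apply: eq_bigr => m mp; under eq_bigr do rewrite mxE.
by rewrite (prod_scale_homog _ _ hp mp) mulrCA.
Qed.

Lemma monomial_norms_ge0 (K : numFieldType) (n : nat) (p : mpoly n K)
    (x : 'rV[K]_n) : 0 <= monomial_norms p x.
Proof.
by apply: sumr_ge0 => m _; rewrite mulr_ge0 ?prodr_ge0 // => i _; rewrite exprn_ge0.
Qed.

Lemma norm_meval_homog_le (K : numFieldType) (n d : nat) (p : mpoly n K)
    (s : K) (x y : 'rV[K]_n) :
  p \is ishomog1 d mdeg -> 0 <= s -> (forall i, `|x 0 i| <= s * `|y 0 i|) ->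
  `|meval (x 0) p| <= s ^+ d * monomial_norms p y.
Proof.
move=> hp s0 xy; rewrite mevalE; apply: le_trans (ler_norm_sum _ _ _) _.
rewrite /monomial_norms mulr_sumr big_seq [leRHS]big_seq.
apply: ler_sum => m mp.
rewrite normrM mulrCA ler_wpM2l // -(prod_scale_homog _ _ hp mp) normr_prod.
by apply: ler_prod => i _; rewrite normr_ge0 normrX lerXn2r ?nnegrE ?mulr_ge0 /=.
Qed.

Lemma coord_norm_le (K : numFieldType) (n : nat) (x : 'rV[K]_n) (i : 'I_n) :
  `|x 0 i| <= `|x|.
Proof.
rewrite [leRHS]/Num.norm /= mx_normE [_ <= _%:num]num_le.
exact: (le_bigmax _ (fun j : 'I_1 * 'I_n => `|x j.1 j.2|%:nng) (0, i)).
Qed.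

(** Equality fails for [n = 0], where the row is empty and has norm 0. *)
Lemma norm_const_mx_le (K : numFieldType) (n : nat) (c : K) :
  `|const_mx c : 'rV[K]_n| <= `|c|.
Proof.
rewrite [leLHS]/Num.norm /= mx_normE [_%:num <= _]num_le.
by apply/bigmax_leP; split => [|i _]; rewrite -num_le /= ?mxE.
Qed.

Lemma cvg_dist_le (K : numFieldType) (a : nat -> K) (l c b : K) (N : nat) :
  a @ \oo --> l -> (forall j, (N <= j)%N -> `|a j - c| <= b) -> `|l - c| <= b.
Proof.
(* The order of [K] may be partial; [b] dominates a norm, hence is real and comparable with the
   distance from [l] to [c]. *)
move=> al ab; have b0 : 0 <= b by apply: le_trans (ab N _).
have [//|bl] := real_leP (normr_real (l - c)) (ger0_real b0).
have e0 : 0 < `|l - c| - b by rewrite subr_gt0.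
have /cvgrPdist_lt /(_ _ e0) [M _ HM] := al.
have := HM (maxn M N) (leq_maxl _ _).
have := ab (maxn M N) (leq_maxr _ _).
set d := a _ => h1 /=; rewrite ltrBrDr => h2.
have : `|l - c| <= `|l - d| + `|d - c| by rewrite (le_trans _ (ler_normD _ _)) // subrKA.
move=> h3; have := le_lt_trans (lerD (lexx `|l - d|) h1) h2.
by rewrite (le_gtF h3).
Qed.

(* The terms of degree at least [N] are compared with those of the absolutely
   convergent series at the diagonal point (r, ..., r), which leaves a factor
   (|x| / r)^N. *)
Lemma expansion_remainder (K : numFieldType) (n : nat) (f : 'rV[K]_n -> K)
    (p : nat -> mpoly n K) (N : nat) :
  expansion_at f 0 p ->
  exists2 B : K, 0 <= B & \forall x \near (0 : 'rV[K]_n),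
    `|f x - \sum_(0 <= j < N) meval (x 0) (p j)| <= B * `|x| ^+ N.
Proof.
move=> [hp /nbhs_normP [e /= e0 He]].
(* Halving [e] puts the diagonal point [y] strictly inside the ball of absolute convergence. *)
pose r := e / 2; have r0 : 0 < r by rewrite divr_gt0.
have re : r < e by rewrite ltr_pdivrMr // ltr_pMr // ltr1n.
pose y : 'rV[K]_n := const_mx r.
have ye : `|y| < e.
  by apply: le_lt_trans re; rewrite -[leRHS](gtr0_norm r0) norm_const_mx_le.
have [] : abs_converges_to p (y - 0) (f y) by apply: He; rewrite /= sub0r normrN.
rewrite subr0 => /cvg_seq_bounded /pinfty_ex_gt0 [M M0 HM] _.
(* [M] bounds the partial sums of [monomial_norms] at [y]. *)
exists (M / r ^+ N); first by rewrite ltW // divr_gt0 // exprn_gt0.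
apply/nbhs_normP; exists r => //= x /=; rewrite sub0r normrN => xr.
have [_] : abs_converges_to p (x - 0) (f x).
  by apply: He; rewrite /= sub0r normrN (lt_trans xr).
rewrite subr0 => cx; apply: (cvg_dist_le (N := N) cx) => j Nj.
pose s := `|x| / r.
have s0 : 0 <= s by rewrite divr_ge0 // ltW.
have s1 : s <= 1 by rewrite ler_pdivrMr // mul1r ltW.
rewrite /series /= (big_cat_nat (n := N)) //= [X in X - _]addrC addrK.
apply: le_trans (ler_norm_sum _ _ _) _.
have -> : M / r ^+ N * `|x| ^+ N = s ^+ N * M.
  by rewrite [s ^+ N]expr_div_n mulrAC (mulrC M) mulrAC.
(* The part of degree [i] gains a factor [s ^+ i], at most [s ^+ N] because [s <= 1] and
   [N <= i]. *)
apply: (@le_trans _ _ (s ^+ N * \sum_(N <= i < j) monomial_norms (p i) y)).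
  rewrite mulr_sumr big_nat [leRHS]big_nat; apply: ler_sum => i /andP[Ni _].
  apply: (@le_trans _ _ (s ^+ i * monomial_norms (p i) y)).
    apply: norm_meval_homog_le => // l; rewrite mxE (gtr0_norm r0) divfK ?gt_eqF //.
    exact: coord_norm_le.
  by rewrite ler_wpM2r ?monomial_norms_ge0 // ler_wiXn2l.
rewrite ler_wpM2l ?exprn_ge0 //.
have := HM j I; rewrite /= /series /= ger0_norm; last first.
  by apply: sumr_ge0 => i _; apply: monomial_norms_ge0.
apply: le_trans; rewrite (big_cat_nat (m := 0%N) (n := N)) //= lerDr.
by apply: sumr_ge0 => i _; apply: monomial_norms_ge0.
Qed.

(** Here [z] stands for half of the second-order vectors, which removes the factor 1/2 from the
    equation. *)
Lemma initial_forms_second_tangent (K : numFieldType) (n : nat)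
    (f : 'rV[K]_n -> K) (p : nat -> mpoly n K) (m : nat) (u w : 'rV[K]_n)
    (t : nat -> K) (z : nat -> 'rV[K]_n) :
  expansion_at f 0 p -> initial_degree p m ->
  (forall j, 0 < t j) -> t @ \oo --> (0 : K) -> z @ \oo --> w ->
  (\forall j \near \oo, f (t j *: (u + t j *: z j)) = 0) ->
  \sum_(i < n) meval (u 0) (mderiv i (p m)) * w 0 i
    + meval (u 0) (p m.+1) = 0.
Proof.
move=> fp [_ p0] tp t0 zw fx0; have hp := fp.1.
pose v j := u + t j *: z j; pose x j := t j *: v j.
have vu : v @ \oo --> u by exact: cvg_along_ray t0 zw.
have x0 : x @ \oo --> (0 : 'rV[K]_n).
  by rewrite -(scale0r u); apply: cvgZ.
have tn0 j : t j != 0 by rewrite gt_eqF.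
(* By homogeneity, [t j ^+ m * q j] is the sum of the parts of degree below [m.+2] at [x j]. *)
pose q j := meval (v j 0) (p m) + t j * meval (v j 0) (p m.+1).
have [B B0 HB] := expansion_remainder m.+2 fp.
have /cvg_seq_bounded /pinfty_ex_gt0 [M M0 HM] : cvgn v by apply/cvg_ex; exists u.
pose C := B * M ^+ m.+2.
(* The remainder at [x j] is at most [B] times the power [m.+2] of [t j * M], where [M] bounds [v];
   dividing by [t j ^+ m] leaves [t j ^+ 2]. *)
have Cq : \forall j \near \oo, `|q j| <= C * t j ^+ 2.
  near=> j.
  have : `|f (x j) - \sum_(0 <= i < m.+2) meval (x j 0) (p i)|
      <= B * `|x j| ^+ m.+2.
    by near: j; apply: (x0 _ HB).
  have -> : f (x j) = 0 by near: j.
  have -> : \sum_(0 <= i < m.+2) meval (x j 0) (p i) = t j ^+ m * q j.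
    rewrite big_nat_recr //= big_nat_recr //= big_nat big1 => [|i /andP[_ im]].
      by rewrite add0r !(meval_homogZ _ _ (hp _)) exprSr mulrDr mulrA.
    by rewrite p0 // meval0.
  rewrite sub0r normrN normrM normrX (gtr0_norm (tp j)) => H.
  rewrite -(ler_pM2l (exprn_gt0 m (tp j))) (le_trans H) //.
  rewrite normrZ (gtr0_norm (tp j)) exprMn.
  apply: (@le_trans _ _ (B * (t j ^+ m.+2 * M ^+ m.+2))).
    rewrite ler_wpM2l // ler_wpM2l ?exprn_ge0 ?(ltW (tp j)) //.
    by rewrite lerXn2r ?nnegrE ?(ltW M0) //; exact: HM.
  have -> : t j ^+ m.+2 = t j ^+ m * t j ^+ 2 by rewrite -exprD addn2.
  by rewrite -mulrA mulrCA (mulrC (t j ^+ 2)) (mulrA B).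
have C0 : 0 <= C by rewrite mulr_ge0 // exprn_ge0 // ltW.
clearbody C.
have tq : (fun j => (t j)^-1 * q j) @ \oo --> (0 : K).
  have Ct : (fun j => C * t j) @ \oo --> (0 : K).
    by rewrite -(mulr0 C); apply: cvgM => //; exact: cvg_cst.
  apply/cvgr0Pnorm_le => eps eps0.
  move/cvgr0Pnorm_le/(_ _ eps0): Ct => Ct; near=> j.
  have : `|C * t j| <= eps by near: j.
  apply: le_trans; rewrite !normrM normfV (ger0_norm C0) (gtr0_norm (tp j)).
  rewrite mulrC ler_pdivrMr // -mulrA -expr2.
  by near: j.
have pm1 := meval_cvg (p := p m.+1) vu.
(* Order 0: [q] tends to 0, and also to the value of [p m] at [u]. *)
have pmu : meval (u 0) (p m) = 0.
  have q0 : q @ \oo --> (0 : K).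
    have -> : q = (fun j => t j * ((t j)^-1 * q j)).
      by apply/funext => j; rewrite mulVKf.
    by rewrite -(mulr0 0); apply: cvgM.
  have q1 : q @ \oo --> meval (u 0) (p m) + 0 * meval (u 0) (p m.+1).
    by apply: cvgD; [exact: meval_cvg|exact: cvgM].
  rewrite mul0r addr0 in q1.
  exact: (cvg_unique _ q1 q0).
(* Order 1: as [p m] vanishes at [u], subtracting that value turns [q j] over [t j] into a
   difference quotient plus [p m.+1] at [v j]. *)
have tq1 : (fun j => (t j)^-1 * q j) @ \oo -->
    \sum_(i < n) meval (u 0) (mderiv i (p m)) * w 0 i + meval (u 0) (p m.+1).
  have -> : (fun j => (t j)^-1 * q j) = (fun j =>
      (t j)^-1 * (meval (v j 0) (p m) - meval (u 0) (p m))
      + meval (v j 0) (p m.+1)).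
    by apply/funext => j; rewrite pmu subr0 mulrDr mulKf.
  by apply: cvgD => //; exact: meval_derive.
exact: (cvg_unique _ tq1 tq).
Unshelve. all: by end_near.
Qed.

(** * Real parameters as scalars, and the two inclusions *)

Lemma of_real_gt0 (R : realType) (k : scalar_kind) (t : R) :
  (0 < of_real k t) = (0 < t).
Proof. by case: k => //=; rewrite -ltcR. Qed.

Lemma cvg_of_real0 (R : realType) (k : scalar_kind) (t : nat -> R) :
  t @ \oo --> (0 : R) -> (fun j => of_real k (t j)) @ \oo --> (0 : scalars R k).
Proof.
move=> t0; apply/cvgr0Pnorm_le => eps eps0.
case: k eps eps0 => /= eps eps0.
  by move/cvgr0Pnorm_le/(_ _ eps0): t0.
(* A positive element of [R[i]] is real, so the tolerance descends to [R]. *)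
have eR : eps = (complex.Re eps)%:C%C by rewrite RRe_real // gtr0_real.
have e0 : 0 < complex.Re eps by rewrite -ltcR -eR.
move/cvgr0Pnorm_le/(_ _ e0): t0; apply: filterS => j.
by rewrite eR normc_def /= expr0n addr0 sqrtr_sqr lecR.
Qed.

Lemma second_tangent_algebraic (R : realType) (k : scalar_kind) (n : nat)
    (X : set 'rV[scalars R k]_n) (u : 'rV[scalars R k]_n) :
  second_tangent X u `<=` algebraic_second_tangent X u.
Proof.
move=> w [t [w_ [t0 _ tto0 ww Xw]]] f [V [oV V0 _ fV]] _ p m fp pm.
set T := fun j => of_real k (t j).
have T0 j : 0 < T j by rewrite of_real_gt0.
have Tto0 : T @ \oo --> 0 by exact: cvg_of_real0.
have zw : (fun j => 2^-1 *: w_ j) @ \oo --> 2^-1 *: w.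
  by apply: cvgZr.
have E j : T j *: u + (2^-1 * T j ^+ 2) *: w_ j
    = T j *: (u + T j *: (2^-1 *: w_ j)).
  by rewrite scalerDr !scalerA expr2 mulrC.
apply: etrans (initial_forms_second_tangent (u := u) fp pm T0 Tto0 zw _).
  congr (_ + _); rewrite mulr_sumr; apply: eq_bigr => i _.
  by rewrite mxE mulrCA.
have x0 : (fun j => T j *: (u + T j *: (2^-1 *: w_ j))) @ \oo -->
    (0 : 'rV[scalars R k]_n).
  by rewrite -(scale0r u); apply: cvgZ => //; exact: cvg_along_ray Tto0 zw.
(* The points tend to 0, so they eventually enter [V], where [f] vanishes on [X]. *)
near=> j; apply: fV; first by rewrite -E; exact: Xw.
by near: j; exact: x0 _ (open_nbhs_nbhs (conj oV V0)).
Unshelve. all: by end_near.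
Qed.

Lemma realizable_second_tangent (R : realType) (k : scalar_kind) (n : nat)
    (X : set 'rV[scalars R k]_n) (u : 'rV[scalars R k]_n) :
  second_order_realizable X u ->
  algebraic_second_tangent X u `<=` second_tangent X u.
Proof.
move=> hreal w /hreal [e [g [e0 Xg _ gw]]].
(* The shift by 2 gives [t j < e] already at [j = 0]. *)
pose t (j : nat) : R := e / (j.+2)%:R.
have t0 j : 0 < t j by rewrite divr_gt0.
have te j : t j < e by rewrite ltr_pdivrMr // ltr_pMr // ltr1n.
have tto0 : t @ \oo --> (0 : R).
  rewrite -(mulr0 e); apply: cvgM; first exact: cvg_cst.
  exact: (cvg_comp _ _ (cvg_addnl 1) cvg_harmonic).
set T := fun j => of_real k (t j).
have T0 j : 0 < T j by rewrite of_real_gt0.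
(* The vectors are obtained by solving [g (t j) = T j *: u + (2^-1 * T j ^+ 2) *: w_ j] for
   [w_ j]. *)
exists t, (fun j => (2 / T j ^+ 2) *: (g (t j) - T j *: u)); split => //.
- move=> i j ij; rewrite /t ler_pM2l // lef_pV2 ?posrE //.
  by rewrite ler_nat.
- apply/cvgrPdist_le => eps eps0.
  (* The error of the curve is multiplied by [2 / T j ^+ 2] below, so [eps / 2] yields [eps]. *)
  have e20 : 0 < eps / 2 by rewrite divr_gt0.
  move/eqoP: gw => /(_ _ e20) gw.
  near=> j.
  have : 0 < t j -> `|g (t j) - (T j *: u + (2^-1 * T j ^+ 2) *: w)|
      <= eps / 2 * `|T j ^+ 2|.
    by near: j; exact: tto0 _ gw.
  move=> /(_ (t0 j)); rewrite normrX (gtr0_norm (T0 j)) => H.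
  have T2 : 0 < 2 / T j ^+ 2 by rewrite divr_gt0 // exprn_gt0.
  have -> : w - (2 / T j ^+ 2) *: (g (t j) - T j *: u) =
    - ((2 / T j ^+ 2) *: (g (t j) - (T j *: u + (2^-1 * T j ^+ 2) *: w))).
    rewrite opprD addrA [in RHS]scalerBr scalerA opprB.
    by rewrite mulrACA mulVf ?expf_neq0 ?gt_eqF // mulfV // mul1r scale1r.
  rewrite normrN normrZ (gtr0_norm T2).
  apply: le_trans (ler_wpM2l (ltW T2) H) _.
  by rewrite [_ * T j ^+ 2]mulrC mulrA divfK ?expf_neq0 ?gt_eqF // mulrC divfK.
- move=> j; rewrite scalerA -/(T j).
  rewrite mulrACA mulVf // mul1r mulrC mulVf ?expf_neq0 ?gt_eqF // scale1r.
  by rewrite addrC subrK; apply: Xg; rewrite t0 te.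
Unshelve. all: by end_near.
Qed.

Unset Implicit Arguments.

Theorem theorem4p2 (R : realType) (k : scalar_kind) (n : nat)
    (U X : set 'rV[scalars R k]_n) (u : 'rV[scalars R k]_n)
    (hX : analytic_set U X) (hX0 : X 0)
    (hu : tangent_cone X u) (hu0 : u <> 0)
    (hreal : second_order_realizable X u) :
  second_tangent X u = algebraic_second_tangent X u.
Proof.
apply/seteqP; split; first exact: second_tangent_algebraic.
exact: realizable_second_tangent.
Qed.
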